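(* Let $G$ be a connected, triangle-free graph of order $n$ and size $m$. Then \[ \rho(G) \leq \frac{n}{2} + 2 - \frac{2m}{n-1}. \]
   Context: All graphs are finite and simple. For a connected graph $G$ of order $n\ge 2$ and a vertex $v$, $\overline{\sigma}_G(v)=\frac{1}{n-1}\sum_{w\in V(G)} d_G(v,w)$; the remoteness is $\rho(G)=\max_{v}\overline{\sigma}_G(v)$. Size means number of edges. A graph is triangle-free if it contains no subgraph isomorphic to $K_3$. *)

(* Defs.v *)
From mathcomp Require Import all_boot all_order all_algebra.

Set Implicit Arguments.
Unset Strict Implicit.
Unset Printing Implicit Defensive.

Import Order.TTheory GRing.Theory Num.Theory.

Record sgraph := SGraph {
  vertex :> finType;
  adj : rel vertex;
  adj_sym : symmetric adj;
  adj_irrefl : irreflexive adj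
}.

Section Graph.

Variable G : sgraph.
Implicit Types u v w : G.

Definition connected_graph : Prop := forall u v, connect (@adj G) u v.

Definition edges : {set {set G}} := [set [set u; v] | u in G, v in G & adj u v].

Definition graph_order : nat := #|G|.

Definition graph_size : nat := #|edges|.

(* There is a u-v path (no repeated vertex) with exactly k edges; the vertices
   of the path are u followed by the k items of p. *)
Definition has_path (k : nat) u v : bool :=
  [exists p : k.-tuple G, [&& path (@adj G) u p, uniq (u :: p) & last u p == v]].

(* Length of a shortest u-v path. Paths have fewer than #|G| edges, so the
   search range is large enough; the value is #|G| when v is unreachable. *)
Definition dist u v : nat := find (fun k => has_path k u v) (iota 0 #|G|).

Lemma distP u v : connect (@adj G) u v ->
  has_path (dist u v) u v /\ forall k, has_path k u v -> dist u v <= k.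
Proof.
have hb k x : has_path k u x -> k < #|G|.
  case/existsP=> p /and3P[_ Up _].
  have := max_card (mem (u :: p)); by rewrite (card_uniqP Up) /= size_tuple.
case/connectP=> p0 Pp0 ->; case/shortenP: Pp0 => p Pp Up _.
set v' := last u p.
have hp : has_path (size p) u v'.
  by apply/existsP; exists (in_tuple p); apply/and3P; split; rewrite ?/v'.
have hh : has (fun k => has_path k u v') (iota 0 #|G|).
  by apply/hasP; exists (size p); rewrite // mem_iota (hb _ _ hp).
split.
  have := nth_find 0 hh; rewrite nth_iota //.
  by move: hh; rewrite has_find size_iota.
move=> k hk; rewrite leqNgt; apply/negP=> lt.
have := before_find 0 lt; rewrite nth_iota ?add0n ?hk //; exact: hb hk.
Qed.

Local Open Scope ring_scope.

Definition avg_dist v : rat := (\sum_(w : G) dist v w)%N%:R / (#|G|%:R - 1).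

(* The averages are nonnegative, so 0 is a neutral start value for the maximum
   over the (nonempty) vertex set. *)
Definition remoteness : rat := \big[Num.max/0]_(v : G) avg_dist v.

End Graph.

Lemma complete_sym k : symmetric (fun i j : 'I_k => i != j).
Proof. by move=> i j; rewrite eq_sym. Qed.

Lemma complete_irrefl k : irreflexive (fun i j : 'I_k => i != j).
Proof. by move=> i; rewrite eqxx. Qed.

Definition complete (k : nat) : sgraph :=
  SGraph (@complete_sym k) (@complete_irrefl k).

Definition has_subgraph_iso (H G : sgraph) : Prop :=
  exists2 f : H -> G, injective f & forall x y : H, adj x y -> adj (f x) (f y).

Definition triangle_free (G : sgraph) : Prop := ~ has_subgraph_iso (complete 3) G.

(* Main.v *)
Require Import Defs.
From mathcomp Require Import all_boot all_order all_algebra.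
From mathcomp Require Import zify lra.
Import Order.TTheory GRing.Theory Num.Theory.
Local Open Scope ring_scope.

Set Implicit Arguments.
Unset Strict Implicit.
Unset Printing Implicit Defensive.

(** Fix a vertex [v] and layer [G] by the distance from [v]. It suffices to show
    [2 * sum_w d(v,w) + 4 * m + 4 <= n ^ 2 + 3 * n]. This holds for every vertex set
    [S] with a layer function [f] that varies by at most one along edges and
    whose values on [S] form an initial segment of the naturals, so that vertices can be
    deleted without preserving connectedness. By induction on [#|S|], let [x] be
    in the last layer. If [x] has at most one neighbour, delete [x].
    Otherwise delete [x] and a neighbour [y] in the highest possible layer:
    as there are no triangles, [x] and [y] have disjoint neighbourhoods, which
    both avoid the layers below [f y - 1]. *)

Section Layering.

Local Open Scope nat_scope.

Variable (G : sgraph).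
Implicit Types (S : {set G}) (f : G -> nat) (u v w x y : G).

Definition nbrs S x : {set G} := [set w in S | adj x w].

Definition degree_sum S : nat := \sum_(u in S) #|nbrs S u|.

Definition initial_segment S f : Prop :=
  forall u k, u \in S -> k <= f u -> exists2 w, w \in S & f w = k.

(** Deleting [x] removes its own degree and lowers that of each neighbour by one. *)
Lemma degree_sumD1 S x : x \in S ->
  degree_sum S = degree_sum (S :\ x) + 2 * #|nbrs S x|.
Proof.
move=> xS; rewrite /degree_sum (big_setD1 x xS) /=.
have -> : \sum_(u in S :\ x) #|nbrs S u|
   = \sum_(u in S :\ x) (adj x u + #|nbrs (S :\ x) u|).
  apply: eq_bigr => u _; rewrite (cardsD1 x) !inE xS /= adj_sym; congr (_ + _).
  by apply: eq_card => w; rewrite !inE andbA.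
rewrite big_split /=.
have -> : \sum_(u in S :\ x) (adj x u : nat) = #|nbrs S x|.
  rewrite -sum1_card [RHS](eq_bigl (fun u => (u \in S :\ x) && adj x u)).
    by rewrite big_mkcondr; apply: eq_bigr => u _; case: ifP.
  by move=> u; rewrite !inE; case: eqP => // ->; rewrite adj_irrefl andbF.
lia.
Qed.

Lemma nbrsD1 S x y : x \in S -> adj x y ->
  #|nbrs S y| = (#|nbrs (S :\ x) y|).+1.
Proof.
move=> xS xy; rewrite (cardsD1 x) !inE xS adj_sym xy add1n; congr _.+1.
by apply: eq_card => w; rewrite !inE andbA.
Qed.

(** Each of the layers 0, ..., [k - 1] is at most [f x], hence nonempty. *)
Lemma initial_segment_card S f x k : initial_segment S f -> x \in S ->
  k <= (f x).+1 -> k <= #|[set w in S | f w < k]|.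
Proof.
move=> segf xS kfx; rewrite cardE -(size_map f) -[leqLHS](size_iota 0).
apply: uniq_leq_size (iota_uniq _ _) _ => j; rewrite mem_iota add0n /= => jk.
have [|w wS fw] := segf x j xS; first lia.
by apply/mapP; exists w; rewrite // mem_enum !inE wS fw.
Qed.

Lemma layered_bound S f :
    (forall x y w, adj x y -> adj x w -> ~~ adj y w) ->
    (forall x y, adj x y -> f x <= (f y).+1) ->
    initial_segment S f -> 0 < #|S| ->
  2 * \sum_(u in S) f u + 2 * degree_sum S + 4 <= #|S| * (#|S| + 3).
Proof.
move=> tf lip; have [n] := ubnP #|S|; elim: n S => // n IH S ltn segf S0.
have [x0 x0S] : exists x, x \in S by apply/set0Pn; rewrite -card_gt0.
case: (arg_maxnP f x0S) => x xS0 xmax {x0 x0S}.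
have {xS0} xS : x \in S := xS0.
have le_f : f x < #|S|.
  apply: (leq_trans (@initial_segment_card _ _ _ _ segf xS (leqnn _))).
  by apply: subset_leq_card; apply/subsetP => w; rewrite inE => /andP[].
have cS : #|S| = #|S :\ x|.+1 by rewrite (cardsD1 x) xS.
(* A layer strictly below [f u <= f x] cannot lose [x]; layer [f u] still contains [u]. *)
have segx : initial_segment (S :\ x) f.
  move=> u k; rewrite !inE => /andP[ux uS] ku.
  have [E|kx] := eqVneq k (f u); first by exists u; rewrite // !inE ux.
  have [w wS fw] := segf u k uS ku; exists w; rewrite // !inE wS andbT.
  by apply: contra kx => /eqP E; have := xmax u uS; rewrite -E fw; lia.
have sumx : \sum_(u in S) f u = f x + \sum_(u in S :\ x) f u.
  exact: big_setD1.
have degx := degree_sumD1 xS.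
have [dx|dx] := leqP #|nbrs S x| 1.
  have [c0|c0] := posnP #|S :\ x|.
    have E : S :\ x = set0 by apply/eqP; rewrite -cards_eq0 c0.
    have : #|nbrs S x| = 0.
      apply: eq_card0 => w; have := in_set0 w; rewrite -E !inE.
      by case: eqP => [->|_ /= ->]; rewrite ?adj_irrefl ?andbF.
    have : degree_sum (S :\ x) = 0 by rewrite E /degree_sum big_set0.
    have : \sum_(u in S :\ x) f u = 0 by rewrite E big_set0.
    by rewrite sumx degx cS c0; rewrite cS c0 in le_f; lia.
  (* With s = [#|S|], the left side drops by at most 2(s - 1) + 4, and the right side by exactly 2s
     + 2. *)
  have := IH (S :\ x) _ segx c0; rewrite -ltnS -cS ltn => /(_ isT).
  by rewrite sumx degx cS; rewrite cS in le_f; nia.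
have [y0 y0N] : exists y, y \in nbrs S x by apply/set0Pn; rewrite -card_gt0; lia.
case: (arg_maxnP f y0N) => y yN0 ymax {y0 y0N}.
have {yN0} yN : y \in nbrs S x := yN0.
move: (yN); rewrite inE => /andP[yS xy].
have [y'] : exists y', y' \in nbrs S x :\ y.
  by apply/set0Pn; rewrite -card_gt0; move: dx; rewrite (cardsD1 y) yN; lia.
rewrite in_setD1 => /andP[y'y y'N].
have fy' := ymax _ y'N; move: (y'N); rewrite inE => /andP[y'S xy'].
have yx : y != x by apply: contraTneq xy => ->; rewrite adj_irrefl.
have y'x : y' != x by apply: contraTneq xy' => ->; rewrite adj_irrefl.
have ySx : y \in S :\ x by rewrite !inE yx.
have cSx : #|S :\ x| = #|S :\ x :\ y|.+1 by rewrite (cardsD1 y) ySx.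
have fxy := lip _ _ xy; have fxy' := lip _ _ xy'.
have fyx := xmax _ yS.
(* If [y] was the witness for a layer [k < f u], then [f y < f x]. Both neighbours of [x] lie at
   layer [f x - 1] or above, and [f y' <= f y], so [y'] shares the layer of [y] and replaces it. *)
have segy : initial_segment (S :\ x :\ y) f.
  move=> u k uS ku; have uSx : u \in S :\ x by move: uS; rewrite inE => /andP[].
  have [w wS fw] := segx u k uSx ku.
  have [wy|wy] := eqVneq w y; last by exists w; rewrite // in_setD1 wy.
  have [E|ku'] := eqVneq k (f u); first by exists u.
  exists y'; first by rewrite !inE y'y y'x.
  have := xmax u; move: uSx; rewrite inE => /andP[_ uS'] /(_ uS').
  by rewrite wy in fw; lia.
have sumy : \sum_(u in S :\ x) f u = f y + \sum_(u in S :\ x :\ y) f u.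
  exact: big_setD1.
have degy := degree_sumD1 ySx.
have nby := nbrsD1 xS xy.
have c0 : 0 < #|S :\ x :\ y|.
  by rewrite card_gt0; apply/set0Pn; exists y'; rewrite !inE y'y y'x.
(* Neighbours of [y] have layer at least [f y - 1], and so do those of [x], since [f y <= f x]. *)
have cards : #|nbrs S x| + #|nbrs S y| + (f y).-1 <= #|S|.
  set A := [set w in S | f w < (f y).-1].
  have cA : (f y).-1 <= #|A|.
    by apply: initial_segment_card segf xS _; lia.
  have dis : [disjoint nbrs S x & nbrs S y].
    rewrite -setI_eq0; apply/eqP/setP => w; rewrite !inE.
    by case xw : (adj x w); rewrite ?andbF // (negPf (tf _ _ _ xy xw)) !andbF.
  have dis' : [disjoint nbrs S x :|: nbrs S y & A].
    rewrite -setI_eq0; apply/eqP/setP => w; rewrite !inE.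
    apply/negP => /andP[/orP[]/andP[_ /lip H]] /andP[_ ?]; lia.
  apply: leq_trans (_ : #|nbrs S x :|: nbrs S y :|: A| <= _).
    by rewrite !cardsU !disjoint_setI0 // !cards0 !subn0 leq_add2l.
  apply: subset_leq_card; apply/subsetP => w; rewrite !inE.
  by case: (w \in S).
(* The edge [xy] is counted once, so the left side drops by 2([f x] + [f y]) + 4(d(x) + d(y) - 1).
   By [cards] and [f x <= f y + 1] this is at most 4s + 2, the drop of the right side. *)
have := IH (S :\ x :\ y) _ segy c0.
have -> : #|S :\ x :\ y| < n by lia.
move=> /(_ isT).
by rewrite sumx sumy degx degy cS cSx; rewrite cS cSx in cards; nia.
Qed.

(** The degree sum counts ordered adjacent pairs, and [h] sends the distinct pairs (u, w) and (w, u)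
    to the same edge. *)
Lemma size_le_degree_sum : 2 * graph_size G <= degree_sum [set: G].
Proof.
pose P := [set p : G * G | adj p.1 p.2].
pose h (p : G * G) := [set p.1; p.2].
have -> : degree_sum setT = #|P|.
  rewrite -sum1_card /degree_sum.
  rewrite (eq_bigr (fun u => \sum_(w | adj u w) 1)); last first.
    by move=> u _; rewrite -sum1_card; apply: eq_bigl => w; rewrite !inE.
  by rewrite pair_big_dep /=; apply: eq_bigl => p; rewrite !inE.
have -> : graph_size G = #|h @: P|.
  apply: eq_card => E; apply/imset2P/imsetP.
    by case=> u w _; rewrite inE => /andP[_ uw] ->; exists (u, w); rewrite ?inE.
  by case=> -[u w]; rewrite inE /= => uw ->; exists u w; rewrite ?inE.
rewrite -[#|P|]sum1_card (partition_big_imset h) /= mulnC -sum_nat_const.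
apply: leq_sum => _ /imsetP[[u w] uw ->]; rewrite inE /= in uw.
have uw' : u != w by apply: contraTneq uw => ->; rewrite adj_irrefl.
rewrite (bigD1 (u, w)) ?inE ?uw ?eqxx //= (bigD1 (w, u)) //=.
rewrite inE /= adj_sym uw /h /= setUC eqxx /=.
by apply: contraNneq uw' => -[-> _].
Qed.

(** Here [p] may repeat vertices, unlike the paths defining [dist]; it is shortened first. *)
Lemma dist_le_path u p : path (@adj G) u p -> dist u (last u p) <= size p.
Proof.
move=> up; have con : connect (@adj G) u (last u p) by apply/connectP; exists p.
case: (distP con) => _; case/shortenP: up => q uq Uq sub le.
apply: (leq_trans (le (size q) _)).
  by apply/existsP; exists (in_tuple q); apply/and3P; split.
by apply: uniq_leq_size => //; case/andP: Uq.
Qed.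

Lemma dist_path u v : connect (@adj G) u v ->
  exists p, [/\ path (@adj G) u p, last u p = v & size p = dist u v].
Proof.
move=> /distP[/existsP[p /and3P[up _ /eqP lp]] _].
by exists p; rewrite size_tuple.
Qed.

Lemma dist_adj u v w : connected_graph G -> adj v w ->
  dist u v <= (dist u w).+1.
Proof.
move=> con vw; have [p [up lp <-]] := dist_path (con u w).
have := @dist_le_path u (rcons p v).
by rewrite rcons_path last_rcons size_rcons up lp adj_sym vw; apply.
Qed.

Lemma dist_initial_segment u : connected_graph G ->
  initial_segment [set: G] (dist u).
Proof.
move=> con w k _; move: {2}(dist u w - k) (erefl (dist u w - k)) => j.
elim: j w => [|j IH] w Ej kw; first by exists w; rewrite ?inE //; lia.
(* The predecessor of [w] on a shortest path from [u] is exactly one closer to [u]. *)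
have [p [up lp sp]] := dist_path (con u w).
case: (lastP p) up lp sp => [|q z]; first by move=> _ _ /=; lia.
rewrite rcons_path last_rcons size_rcons => /andP[uq qz] zw sq.
have le := dist_le_path uq; have := dist_adj u con.
move=> /(_ w (last u q)); rewrite -zw adj_sym qz zw => /(_ isT) le'.
by apply: (IH (last u q)); lia.
Qed.

Lemma triangle_free_adj : triangle_free G ->
  forall x y w, adj x y -> adj x w -> ~~ adj y w.
Proof.
move=> tf x y w xy xw; apply/negP => yw; apply: tf.
pose t := [tuple x; y; w].
have adjt (i j : 'I_3) : i != j -> adj (tnth t i) (tnth t j).
  rewrite !(tnth_nth x) -val_eqE.
  by case: i j => [[|[|[|i]]] ?] [[|[|[|j]]] ?] //= _; rewrite // adj_sym.
exists (tnth t) => [i j E|i j]; last exact: adjt.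
(* Distinct indices give adjacent, hence distinct, vertices. *)
by apply/eqP; apply: contraT => /adjt; rewrite E adj_irrefl.
Qed.

Lemma distance_sum_bound v : connected_graph G -> triangle_free G ->
  2 * \sum_w dist v w + 4 * graph_size G + 4 <= #|G| * (#|G| + 3).
Proof.
move=> con tf.
have := @layered_bound setT (dist v) (triangle_free_adj tf)
  (fun x y => dist_adj v con) (@dist_initial_segment v con).
rewrite cardsT (eq_bigl xpredT) => [|w]; last by rewrite inE.
have G0 : 0 < #|G| by apply/card_gt0P; exists v.
by move=> /(_ G0); have := size_le_degree_sum; lia.
Qed.

End Layering.

Theorem mainTheorem10 (G : sgraph) (n m : nat)
    (hn : graph_order G = n) (hm : graph_size G = m) (hn2 : (2 <= n)%N)
    (hconn : connected_graph G) (htf : triangle_free G) :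
  remoteness G <= n%:R / 2%:R + 2%:R - (2%:R * m%:R) / (n%:R - 1).
Proof.
have n1 : 0 < n%:R - 1 :> rat by rewrite subr_gt0 ltr1n.
(* Clear the denominators and use (n + 4)(n - 1) = n(n + 3) - 4. *)
have bound (s : nat) : (2 * s + 4 * m + 4 <= n * (n + 3))%N ->
    s%:R / (n%:R - 1) <= n%:R / 2%:R + 2%:R - (2%:R * m%:R) / (n%:R - 1) :> rat.
  rewrite -(ler_nat rat) !natrD !natrM natrD => H.
  rewrite ler_pdivrMr // mulrBl divfK ?gt_eqF //.
  by lra.
have distb v : (2 * \sum_(w : G) dist v w + 4 * m + 4 <= n * (n + 3))%N.
  by rewrite -hm -hn; exact: distance_sum_bound.
have [v0 _] : exists v : G, v \in G.
  by apply/card_gt0P; rewrite -/(graph_order G) hn; lia.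
apply: bigmax_le => [|v _].
  (* The start value 0 of the maximum must also obey the bound: drop the distance sum at [v0]. *)
  by have := bound 0%N; rewrite mul0r; apply; have := distb v0; lia.
by rewrite /avg_dist -/(graph_order G) hn; apply: bound.
Qed.
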